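(* Let $\Phi\subseteq\{I,O,U,\mathit{Self},Q_n,N_n\mid n\in\mathbb N\setminus\{0\}\}$ with $U\in\Phi$, and let $\mathcal T$ be a fuzzy TBox in $\mathcal L_\Phi$. For all fuzzy interpretations $\mathcal I$ and $\mathcal I'$ that are witnessed w.r.t. $\mathcal L_\Phi$ and $\Phi$-bisimilar to each other, $\mathcal I\models\mathcal T$ iff $\mathcal I'\models\mathcal T$.
   Context: Gödel operations on $[0,1]$: $p\otimes q=\min\{p,q\}$, $p\oplus q=\max\{p,q\}$, $\ominus p=1$ if $p=0$ and $0$ otherwise, $(p\Rightarrow q)=1$ if $p\le q$ and $q$ otherwise, $(p\Leftrightarrow q)=(p\Rightarrow q)\otimes(q\Rightarrow p)$. Fix pairwise disjoint sets $\mathsf{CN}$, $\mathsf{RN}$, $\mathsf{IN}$ of concept, role and individual names. A basic role w.r.t. $\Phi$ is $r\in\mathsf{RN}$, or $r^-$ when $I\in\Phi$. Roles and concepts of $\mathcal L_\Phi$: each $r\in\mathsf{RN}$ is a role; if $R,S$ are roles and $C$ a concept then $R\circ S$, $R\sqcup S$, $R^*$, $C?$ are roles; $R^-$ if $I\in\Phi$; $U$ if $U\in\Phi$; concepts: $p\in[0,1]$, $A\in\mathsf{CN}$, $C\sqcap D$, $C\to D$, $\neg C$, $C\sqcup D$, $\forall R.C$, $\exists R.C$; $\{a\}$ ($a\in\mathsf{IN}$) if $O\in\Phi$; $\exists r.\mathit{Self}$ if $\mathit{Self}\in\Phi$; ${\ge}n\,R.C$, ${<}n\,R.C$ for basic $R$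 if $Q_n\in\Phi$; ${\ge}n\,R$, ${<}n\,R$ for basic $R$ if $N_n\in\Phi$. $\top$ is concept $1$. A fuzzy interpretation $\mathcal I$ has a nonempty domain $\Delta^{\mathcal I}$, $a^{\mathcal I}\in\Delta^{\mathcal I}$, $A^{\mathcal I}:\Delta^{\mathcal I}\to[0,1]$, $r^{\mathcal I}:(\Delta^{\mathcal I})^2\to[0,1]$, extended by: $U^{\mathcal I}\equiv1$; $(R^-)^{\mathcal I}(x,y)=R^{\mathcal I}(y,x)$; $(C?)^{\mathcal I}(x,y)=C^{\mathcal I}(x)$ if $x=y$, else $0$; $(R\circ S)^{\mathcal I}(x,y)=\sup_z R^{\mathcal I}(x,z)\otimes S^{\mathcal I}(z,y)$; $(R\sqcup S)^{\mathcal I}=R^{\mathcal I}\oplus S^{\mathcal I}$; $(R^* )^{\mathcal I}(x,y)=\sup\{\min(\{1\}\cup\{R^{\mathcal I}(x_i,x_{i+1})\mid i<n\})\mid n\ge0,x_0=x,x_n=y\}$; $p^{\mathcal I}(x)=p$; $\{a\}^{\mathcal I}(x)=1$ iff $x=a^{\mathcal I}$, else $0$; $(\neg C)^{\mathcal I}=\ominus C^{\mathcal I}$; $\sqcap,\sqcup,\to$ pointwise by $\otimes,\oplus,\Rightarrow$; $(\exists r.\mathit{Self})^{\mathcal I}(x)=r^{\mathcal I}(x,x)$; $(\exists R.C)^{\mathcal I}(x)=\sup_y R^{\mathcal I}(x,y)\otimes C^{\mathcal I}(y)$; $(\forall R.C)^{\mathcal I}(x)=\inf_y(R^{\mathcal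 I}(x,y)\Rightarrow C^{\mathcal I}(y))$; $({\ge}n\,R.C)^{\mathcal I}(x)=\sup\{\min_i(R^{\mathcal I}(x,y_i)\otimes C^{\mathcal I}(y_i))\mid y_1..y_n$ pairwise distinct$\}$; $({<}n\,R.C)^{\mathcal I}(x)=\inf\{\min_i(R^{\mathcal I}(x,y_i)\otimes C^{\mathcal I}(y_i))\Rightarrow e\mid y_1..y_n\}$ with $e=1$ if some $y_j=y_k$ ($j<k$), else $0$; ${\ge}n\,R={\ge}n\,R.\top$, ${<}n\,R={<}n\,R.\top$. Witnessed w.r.t. $\mathcal L_\Phi$: for roles/concepts of $\mathcal L_\Phi$, every infinite set whose infimum (supremum) is taken above has a least (greatest) element. A fuzzy GCI in $\mathcal L_\Phi$ is $(C\sqsubseteq D)\rhd p$ with $C,D$ concepts of $\mathcal L_\Phi$, $\rhd\in\{\ge,>\}$, $p\in(0,1]$; $\mathcal I\models(C\sqsubseteq D)\rhd p$ iff $(C\to D)^{\mathcal I}(x)\rhd p$ for all $x\in\Delta^{\mathcal I}$. A fuzzy TBox is a finite set of fuzzy GCIs; $\mathcal I\models\mathcal T$ iff $\mathcal I$ validates each of them. A fuzzy $\Phi$-bisimulation between $\mathcal I,\mathcal I'$ is $Z:\Delta^{\mathcal I}\times\Delta^{\mathcal I'}\to[0,1]$ with, for all $x,x',A,a,r$ and basic $R$: (i) $Z(x,x')\le(A^{\mathcal I}(x)\Leftrightarrow A^{\mathcal I'}(x'))$; (ii) $\forall y\exists y'$: $Z(x,x')\otimes R^{\mathcal I}(x,y)\le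 Z(y,y')\otimes R^{\mathcal I'}(x',y')$; (iii) $\forall y'\exists y$: $Z(x,x')\otimes R^{\mathcal I'}(x',y')\le Z(y,y')\otimes R^{\mathcal I}(x,y)$; (iv) if $O\in\Phi$: $Z(x,x')=0$ whenever exactly one of $x=a^{\mathcal I}$, $x'=a^{\mathcal I'}$ holds; (v) if $U\in\Phi$: $\forall y\exists y'$ $Z(x,x')\le Z(y,y')$ and $\forall y'\exists y$ $Z(x,x')\le Z(y,y')$; (vi) if $\mathit{Self}\in\Phi$: $Z(x,x')\le(r^{\mathcal I}(x,x)\Leftrightarrow r^{\mathcal I'}(x',x'))$; (vii) if $Q_n\in\Phi$: if $Z(x,x')>0$ and $y_1..y_n$ pairwise distinct with all $R^{\mathcal I}(x,y_j)>0$, there exist pairwise distinct $y'_1..y'_n$ such that for each $i$ some $j$ has $Z(x,x')\otimes\bigotimes_k R^{\mathcal I}(x,y_k)\le Z(y_j,y'_i)\otimes R^{\mathcal I'}(x',y'_i)$, and symmetrically (from $y'_1..y'_n$ pairwise distinct with $R^{\mathcal I'}(x',y'_j)>0$ obtain pairwise distinct $y_1..y_n$ such that for each $i$ some $j$ has $Z(x,x')\otimes\bigotimes_k R^{\mathcal I'}(x',y'_k)\le Z(y_i,y'_j)\otimes R^{\mathcal I}(x,y_i)$); (viii) if $N_n\in\Phi$: as (vii) with right-hand sides $R^{\mathcal I'}(x',y'_i)$ for all $i$, resp. $R^{\mathcal I}(x,y_i)$ for all $i$. $\mathcal I$ and $\mathcal I'$ are $\Phi$-bisimilar if $\mathsf{IN}\ne\emptyset$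 and there is a fuzzy $\Phi$-bisimulation $Z$ between them with $Z(a^{\mathcal I},a^{\mathcal I'})=1$ for all $a\in\mathsf{IN}$. *)

(* Defs.v *)
From HB Require Import structures.
From mathcomp Require Import all_boot all_order all_algebra.
From mathcomp Require Import mathcomp_extra boolp classical_sets cardinality reals.

Set Implicit Arguments.
Unset Strict Implicit.
Unset Printing Implicit Defensive.

Import Order.TTheory GRing.Theory Num.Theory.
Local Open Scope classical_set_scope.
Local Open Scope ring_scope.

(* Truth values are elements of a realType R, with membership in [0, 1]
   required wherever they are given as data. The Goedel conjunction and
   disjunction are Num.min and Num.max. *)

Definition gneg {R : realType} (p : R) : R := if p == 0 then 1 else 0.

Definition gimp {R : realType} (p q : R) : R := if p <= q then 1 else q.

Definition geqv {R : realType} (p q : R) : R :=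
  Num.min (gimp p q) (gimp q p).

(* For a family in [0, 1], the neutral element 1 changes nothing unless n = 0,
   in which case the value is min {1} = 1. *)
Definition gmin {R : realType} (n : nat) (f : 'I_n -> R) : R :=
  \big[Num.min/1]_(i < n) f i.

Inductive feature : Type :=
| FI | FO | FU | FSelf | FQ of nat | FN of nat.

(* The counting features are Q_n and N_n for n >= 1 only. *)
Definition features : set feature :=
  [set f | match f with FQ n | FN n => (0 < n)%N | _ => True end].

(* Raw syntax; role_in and concept_in below carve out the language of Phi.
   CN, RN and IN are the types of concept, role and individual names. *)
Inductive role (R : realType) (CN RN IN : Type) : Type :=
| RName of RN
| RComp of role R CN RN IN & role R CN RN IN
| RUnion of role R CN RN IN & role R CN RN IN
| RStar of role R CN RN IN
| RTest of concept R CN RN IN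
| RInv of role R CN RN IN
| RUniv
with concept (R : realType) (CN RN IN : Type) : Type :=
| CConst of R
| CName of CN
| CAnd of concept R CN RN IN & concept R CN RN IN
| CImp of concept R CN RN IN & concept R CN RN IN
| CNeg of concept R CN RN IN
| COr of concept R CN RN IN & concept R CN RN IN
| CAll of role R CN RN IN & concept R CN RN IN
| CEx of role R CN RN IN & concept R CN RN IN
| CNom of IN
| CSelf of RN
| CGeQ of nat & role R CN RN IN & concept R CN RN IN
| CLtQ of nat & role R CN RN IN & concept R CN RN IN
| CGeN of nat & role R CN RN IN
| CLtN of nat & role R CN RN IN.

Arguments RUniv {R CN RN IN}.

Section Language.
Context {R : realType} {CN RN IN : Type} (Phi : set feature).

Definition basic_role (P : role R CN RN IN) : Prop :=
  match P with
  | RName _ => True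
  | RInv (RName _) => Phi FI
  | _ => False
  end.

Fixpoint role_in (P : role R CN RN IN) : Prop :=
  match P with
  | RName _ => True
  | RComp P1 P2 => role_in P1 /\ role_in P2
  | RUnion P1 P2 => role_in P1 /\ role_in P2
  | RStar P1 => role_in P1
  | RTest C => concept_in C
  | RInv P1 => Phi FI /\ role_in P1
  | RUniv => Phi FU
  end
with concept_in (C : concept R CN RN IN) : Prop :=
  match C with
  | CConst p => 0 <= p <= 1
  | CName _ => True
  | CAnd C1 C2 => concept_in C1 /\ concept_in C2
  | CImp C1 C2 => concept_in C1 /\ concept_in C2
  | CNeg C1 => concept_in C1
  | COr C1 C2 => concept_in C1 /\ concept_in C2
  | CAll P C1 => role_in P /\ concept_in C1
  | CEx P C1 => role_in P /\ concept_in C1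
  | CNom _ => Phi FO
  | CSelf _ => Phi FSelf
  | CGeQ n P C1 => [/\ Phi (FQ n), basic_role P & concept_in C1]
  | CLtQ n P C1 => [/\ Phi (FQ n), basic_role P & concept_in C1]
  | CGeN n P => Phi (FN n) /\ basic_role P
  | CLtN n P => Phi (FN n) /\ basic_role P
  end.

End Language.

Record interp (R : realType) (CN RN IN : Type) : Type := Interp {
  dom : Type;
  dom_inhabited : inhabited dom;
  ind_of : IN -> dom;
  cname_of : CN -> dom -> R;
  rname_of : RN -> dom -> dom -> R;
  cname_of01 : forall A x, 0 <= cname_of A x <= 1;
  rname_of01 : forall r x y, 0 <= rname_of r x y <= 1
}.

(* The sets whose suprema and infima interpret the constructors. They are
   named because the notion of a witnessed interpretation refers to them. *)
Section ValueSets.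
Context {R : realType} {D : Type}.
Implicit Types (rR rS : D -> D -> R) (cC : D -> R) (x y : D) (n : nat).

Definition comp_vals rR rS x y : set R :=
  [set Num.min (rR x z) (rS z y) | z in [set: D]].

(* A path x_0, ..., x_n is given by the first n + 1 values of u. *)
Definition star_vals rR x y : set R :=
  [set p | exists n (u : nat -> D),
     [/\ u 0%N = x, u n = y & p = gmin (fun i : 'I_n => rR (u i) (u i.+1))]].

Definition ex_vals rR cC x : set R :=
  [set Num.min (rR x y) (cC y) | y in [set: D]].

Definition all_vals rR cC x : set R :=
  [set gimp (rR x y) (cC y) | y in [set: D]].

Definition ge_vals n rR cC x : set R :=
  [set gmin (fun i => Num.min (rR x (y i)) (cC (y i)))
     | y in [set y : 'I_n -> D | injective y]].

Definition lt_vals n rR cC x : set R :=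
  [set gimp (gmin (fun i => Num.min (rR x (y i)) (cC (y i))))
            (if `[< exists j k : 'I_n, (j < k)%N /\ y j = y k >] then 1 else 0)
     | y in [set: 'I_n -> D]].

End ValueSets.

(* In sup and inf of the library, the empty set has value 0. The only value set
   that can be empty is ge_vals, whose supremum in [0, 1] is then indeed 0. *)
(* The unqualified constructors CGeN and CLtN are the qualified ones taken at
   the top concept, whose interpretation is constantly 1. *)
Section Semantics.
Context {R : realType} {CN RN IN : Type} (I : interp R CN RN IN).

Fixpoint role_sem (P : role R CN RN IN) : dom I -> dom I -> R :=
  match P with
  | RName r => rname_of r
  | RComp P1 P2 => fun x y => sup (comp_vals (role_sem P1) (role_sem P2) x y)
  | RUnion P1 P2 => fun x y => Num.max (role_sem P1 x y) (role_sem P2 x y)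
  | RStar P1 => fun x y => sup (star_vals (role_sem P1) x y)
  | RTest C => fun x y => if `[< x = y >] then concept_sem C x else 0
  | RInv P1 => fun x y => role_sem P1 y x
  | RUniv => fun _ _ => 1
  end
with concept_sem (C : concept R CN RN IN) : dom I -> R :=
  match C with
  | CConst p => fun _ => p
  | CName A => cname_of A
  | CAnd C1 C2 => fun x => Num.min (concept_sem C1 x) (concept_sem C2 x)
  | CImp C1 C2 => fun x => gimp (concept_sem C1 x) (concept_sem C2 x)
  | CNeg C1 => fun x => gneg (concept_sem C1 x)
  | COr C1 C2 => fun x => Num.max (concept_sem C1 x) (concept_sem C2 x)
  | CAll P C1 => fun x => inf (all_vals (role_sem P) (concept_sem C1) x)
  | CEx P C1 => fun x => sup (ex_vals (role_sem P) (concept_sem C1) x)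
  | CNom a => fun x => if `[< x = ind_of I a >] then 1 else 0
  | CSelf r => fun x => rname_of r x x
  | CGeQ n P C1 => fun x => sup (ge_vals n (role_sem P) (concept_sem C1) x)
  | CLtQ n P C1 => fun x => inf (lt_vals n (role_sem P) (concept_sem C1) x)
  | CGeN n P => fun x => sup (ge_vals n (role_sem P) (fun _ => 1) x)
  | CLtN n P => fun x => inf (lt_vals n (role_sem P) (fun _ => 1) x)
  end.

Definition sup_witnessed (E : set R) : Prop :=
  infinite_set E -> exists2 m, E m & ubound E m.

Definition inf_witnessed (E : set R) : Prop :=
  infinite_set E -> exists2 m, E m & lbound E m.

Record witnessed (Phi : set feature) : Prop := Witnessed {
  witnessed_comp : forall P1 P2, role_in Phi (RComp P1 P2) ->
    forall x y, sup_witnessed (comp_vals (role_sem P1) (role_sem P2) x y);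
  witnessed_star : forall P, role_in Phi (RStar P) ->
    forall x y, sup_witnessed (star_vals (role_sem P) x y);
  witnessed_ex : forall P C, concept_in Phi (CEx P C) ->
    forall x, sup_witnessed (ex_vals (role_sem P) (concept_sem C) x);
  witnessed_all : forall P C, concept_in Phi (CAll P C) ->
    forall x, inf_witnessed (all_vals (role_sem P) (concept_sem C) x);
  witnessed_geQ : forall n P C, concept_in Phi (CGeQ n P C) ->
    forall x, sup_witnessed (ge_vals n (role_sem P) (concept_sem C) x);
  witnessed_ltQ : forall n P C, concept_in Phi (CLtQ n P C) ->
    forall x, inf_witnessed (lt_vals n (role_sem P) (concept_sem C) x);
  witnessed_geN : forall n P, concept_in Phi (CGeN n P) ->
    forall x, sup_witnessed (ge_vals n (role_sem P) (fun _ => 1) x);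
  witnessed_ltN : forall n P, concept_in Phi (CLtN n P) ->
    forall x, inf_witnessed (lt_vals n (role_sem P) (fun _ => 1) x)
}.

End Semantics.

Inductive gci_cmp : Type := GciGe | GciGt.

Record gci (R : realType) (CN RN IN : Type) : Type := Gci {
  gci_lhs : concept R CN RN IN;
  gci_rhs : concept R CN RN IN;
  gci_rel : gci_cmp;
  gci_deg : R
}.

Section TBox.
Context {R : realType} {CN RN IN : Type}.

Definition gci_in (Phi : set feature) (g : gci R CN RN IN) : Prop :=
  [/\ concept_in Phi (gci_lhs g), concept_in Phi (gci_rhs g)
    & 0 < gci_deg g <= 1].

Definition fuzzy_tbox (Phi : set feature) (T : set (gci R CN RN IN)) : Prop :=
  finite_set T /\ (forall g, T g -> gci_in Phi g).

Definition gci_valid (I : interp R CN RN IN) (g : gci R CN RN IN) : Prop :=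
  forall x : dom I,
    let v := concept_sem (CImp (gci_lhs g) (gci_rhs g)) x in
    match gci_rel g with
    | GciGe => v >= gci_deg g
    | GciGt => v > gci_deg g
    end.

Definition tbox_valid (I : interp R CN RN IN) (T : set (gci R CN RN IN)) :
  Prop := forall g, T g -> gci_valid I g.

End TBox.

Section Bisimulation.
Context {R : realType} {CN RN IN : Type} (Phi : set feature).
Context (I I' : interp R CN RN IN).
Implicit Types (P : role R CN RN IN).

Record fuzzy_bisimulation (Z : dom I -> dom I' -> R) : Prop :=
  FuzzyBisimulation {
  bisim01 : forall x x', 0 <= Z x x' <= 1;
  bisim_cname : forall x x' (A : CN),
    Z x x' <= geqv (cname_of A x) (cname_of A x');
  bisim_forth : forall x x' P, basic_role Phi P -> forall y, exists y',
    Num.min (Z x x') (role_sem P x y) <= Num.min (Z y y') (role_sem P x' y');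
  bisim_back : forall x x' P, basic_role Phi P -> forall y', exists y,
    Num.min (Z x x') (role_sem P x' y') <= Num.min (Z y y') (role_sem P x y);
  bisim_nom : Phi FO -> forall x x' (a : IN),
    (x = ind_of I a /\ x' <> ind_of I' a) \/
    (x <> ind_of I a /\ x' = ind_of I' a) -> Z x x' = 0;
  bisim_univ_forth : Phi FU -> forall x x' y, exists y', Z x x' <= Z y y';
  bisim_univ_back : Phi FU -> forall x x' y', exists y, Z x x' <= Z y y';
  bisim_self : Phi FSelf -> forall x x' (r : RN),
    Z x x' <= geqv (rname_of r x x) (rname_of r x' x');
  bisim_Q_forth : forall n, Phi (FQ n) ->
    forall x x' P, basic_role Phi P -> 0 < Z x x' ->
    forall y : 'I_n -> dom I, injective y ->
    (forall j, 0 < role_sem P x (y j)) ->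
    exists2 y' : 'I_n -> dom I', injective y' &
      forall i, exists j,
        Num.min (Z x x') (gmin (fun k => role_sem P x (y k)))
          <= Num.min (Z (y j) (y' i)) (role_sem P x' (y' i));
  bisim_Q_back : forall n, Phi (FQ n) ->
    forall x x' P, basic_role Phi P -> 0 < Z x x' ->
    forall y' : 'I_n -> dom I', injective y' ->
    (forall j, 0 < role_sem P x' (y' j)) ->
    exists2 y : 'I_n -> dom I, injective y &
      forall i, exists j,
        Num.min (Z x x') (gmin (fun k => role_sem P x' (y' k)))
          <= Num.min (Z (y i) (y' j)) (role_sem P x (y i));
  bisim_N_forth : forall n, Phi (FN n) ->
    forall x x' P, basic_role Phi P -> 0 < Z x x' ->
    forall y : 'I_n -> dom I, injective y ->
    (forall j, 0 < role_sem P x (y j)) ->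
    exists2 y' : 'I_n -> dom I', injective y' &
      forall i,
        Num.min (Z x x') (gmin (fun k => role_sem P x (y k)))
          <= role_sem P x' (y' i);
  bisim_N_back : forall n, Phi (FN n) ->
    forall x x' P, basic_role Phi P -> 0 < Z x x' ->
    forall y' : 'I_n -> dom I', injective y' ->
    (forall j, 0 < role_sem P x' (y' j)) ->
    exists2 y : 'I_n -> dom I, injective y &
      forall i,
        Num.min (Z x x') (gmin (fun k => role_sem P x' (y' k)))
          <= role_sem P x (y i)
}.

Definition bisimilar : Prop :=
  inhabited IN /\
  exists2 Z : dom I -> dom I' -> R,
    fuzzy_bisimulation Z & forall a, Z (ind_of I a) (ind_of I' a) = 1.

End Bisimulation.

(* Main.v *)
(** Every concept of the language is preserved by a fuzzy bisimulation [Z], in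
    the sense that [min (Z x x') (C x) <= C x'], and every role [P] satisfies
    the forth condition. This is a simultaneous induction on roles and concepts
    in which the bisimulation is universally quantified, so that the converse
    inequality and the back condition follow by transposing [Z]. Witnessedness
    turns the suprema on the side of [x] into attained values. The condition for
    the universal role then links each point to some point at degree [1],
    starting from a named individual; at degree [1] all concepts agree. *)
Require Import Defs.
From HB Require Import structures.
From mathcomp Require Import all_boot all_order all_algebra.
From mathcomp Require Import mathcomp_extra boolp classical_sets cardinality reals.

Set Implicit Arguments.
Unset Strict Implicit.
Unset Printing Implicit Defensive.

Import Order.TTheory GRing.Theory Num.Theory.
Local Open Scope classical_set_scope.

Scheme role_mind := Induction for role Sort Prop
  with concept_mind := Induction for concept Sort Prop.
Combined Scheme role_concept_ind from role_mind, concept_mind.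

(** * Gödel operations, bounds in [0, 1] and attained suprema *)

Section TruthValues.
Context {R : realType}.
Local Open Scope ring_scope.
Implicit Types (p q t : R) (E : set R).

(** Residuation: [gimp p] is right adjoint to the minimum with [p]. The bound [t <= 1] covers the
    case where the implication has value 1. *)
Lemma le_gimp t p q : t <= 1 -> (t <= gimp p q) = (Num.min t p <= q).
Proof.
move=> t1; rewrite /gimp; case: ifP => [pq|/negbT pq].
  by rewrite t1 ge_min pq orbT.
by rewrite ge_min (negbTE pq) orbF.
Qed.

Lemma gneg_gimp p : 0 <= p -> gneg p = gimp p 0.
Proof. by move=> p0; rewrite /gneg /gimp eq_le p0 andbT. Qed.

Lemma gimp01 p q : 0 <= q <= 1 -> 0 <= gimp p q <= 1.
Proof. by rewrite /gimp; case: ifP => // _ _; rewrite ler01 lexx. Qed.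

Lemma geqvC p q : geqv p q = geqv q p.
Proof. by rewrite /geqv minC. Qed.

Lemma le_geqv_trans t p q : t <= 1 -> t <= geqv p q -> t <= p -> t <= q.
Proof.
by move=> t1; rewrite /geqv le_min le_gimp// => /andP[tpq _] /min_idPl tp;
  rewrite tp in tpq.
Qed.

(** The conjunct [t <= 1] comes from the neutral element and is all that remains for [n = 0]. *)
Lemma le_gminP n (f : 'I_n -> R) t :
  t <= gmin f <-> t <= 1 /\ forall i, t <= f i.
Proof.
split=> [/bigmin_geP[t1 tf]|[t1 tf]]; first by split=> // i; exact: tf.
exact/bigmin_geP.
Qed.

Lemma gmin01 n (f : 'I_n -> R) : (forall i, 0 <= f i) -> 0 <= gmin f <= 1.
Proof.
by move=> f0; apply/andP; split; [exact/le_gminP | exact: bigmin_le_id].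
Qed.

Lemma min01 p q : 0 <= p <= 1 -> 0 <= q <= 1 -> 0 <= Num.min p q <= 1.
Proof.
by move=> /andP[p0 p1] /andP[q0 q1]; rewrite le_min p0 q0 ge_min p1.
Qed.

Lemma max01 p q : 0 <= p <= 1 -> 0 <= q <= 1 -> 0 <= Num.max p q <= 1.
Proof.
by move=> /andP[p0 p1] /andP[q0 q1]; rewrite le_max p0 ge_max p1 q1.
Qed.

Definition within01 E := forall p, E p -> 0 <= p <= 1.

Lemma within01_le_sup E p : within01 E -> E p -> p <= sup E.
Proof.
by move=> E01 Ep; apply: ub_le_sup => //; exists 1 => q /E01 /andP[].
Qed.

Lemma within01_ge_inf E p : within01 E -> E p -> inf E <= p.
Proof.
by move=> E01 Ep; apply: ge_inf => //; exists 0 => q /E01 /andP[].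
Qed.

Lemma sup01 E : within01 E -> 0 <= sup E <= 1.
Proof.
(* The empty set is treated apart: its supremum is 0 by convention. *)
move=> E01; have [->|/set0P[p Ep]] := eqVneq E set0; first by rewrite sup0 lexx ler01.
have /andP[p0 _] := E01 _ Ep.
rewrite (le_trans p0 (within01_le_sup E01 Ep))/=.
by apply: ge_sup => [|q /E01 /andP[]//]; exists p.
Qed.

Lemma inf01 E : within01 E -> 0 <= inf E <= 1.
Proof.
move=> E01; have [->|/set0P[p Ep]] := eqVneq E set0; first by rewrite inf0 lexx ler01.
have /andP[_ p1] := E01 _ Ep.
rewrite (le_trans (within01_ge_inf E01 Ep) p1) andbT.
by apply: lb_le_inf => [|q /E01 /andP[]//]; exists p.
Qed.

Lemma finite_set_max E : finite_set E -> E !=set0 ->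
  exists2 m, E m & ubound E m.
Proof.
move=> /finite_seqP[s ->] [p /= ps].
elim: s p ps => // a s IH p _.
(* The induction hypothesis needs an element of the tail, so singletons are the base case. *)
have [->|[q qs]] : s = [::] \/ exists q, q \in s.
  by case: s {IH} => [|q s]; [left | right; exists q; rewrite mem_head].
  by exists a; rewrite /= ?mem_head// => q /=; rewrite mem_seq1 => /eqP ->.
have [m /= ms ub_m] := IH q qs.
have [am|ma] := leP a m.
  by exists m; rewrite /= ?inE ?ms ?orbT// => b /=;
    rewrite inE => /orP[/eqP->//|]; exact: ub_m.
exists a; rewrite /= ?mem_head// => b /=; rewrite inE => /orP[/eqP->//|bs].
exact: le_trans (ub_m _ bs) (ltW ma).
Qed.

(** Witnessedness speaks of infinite sets only; a finite nonempty set has a greatest element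
    anyway. *)
Lemma sup_attained E : sup_witnessed E -> E !=set0 -> E (sup E).
Proof.
move=> wE E0.
have [m Em ub_m] : exists2 m, E m & ubound E m.
  by have [/finite_set_max/(_ E0)|/wE] := pselect (finite_set E).
suff -> : sup E = m by [].
apply/eqP; rewrite eq_le ge_sup//=.
by apply: ub_le_sup => //; exists m.
Qed.

End TruthValues.

(** * Bounds and transposition of the value sets *)

Section ValueSetsTheory.
Context {R : realType} {D : Type}.
Local Open Scope ring_scope.
Implicit Types (rR rS : D -> D -> R) (cC : D -> R) (x y : D).

Definition rel01 rR := forall x y, 0 <= rR x y <= 1.
Definition fun01 cC := forall x, 0 <= cC x <= 1.

Lemma comp_vals01 rR rS x y :
  rel01 rR -> rel01 rS -> within01 (comp_vals rR rS x y).
Proof. by move=> R01 S01 _ [z _ <-]; exact: min01. Qed.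

Lemma star_vals01 rR x y : rel01 rR -> within01 (star_vals rR x y).
Proof.
move=> R01 _ [n [u [_ _ ->]]]; apply: gmin01 => i.
by case/andP: (R01 (u i) (u i.+1)).
Qed.

Lemma ex_vals01 rR cC x : rel01 rR -> fun01 cC -> within01 (ex_vals rR cC x).
Proof. by move=> R01 C01 _ [z _ <-]; exact: min01. Qed.

Lemma all_vals01 rR cC x : fun01 cC -> within01 (all_vals rR cC x).
Proof. by move=> C01 _ [z _ <-]; exact: gimp01. Qed.

Lemma ge_vals01 n rR cC x :
  rel01 rR -> fun01 cC -> within01 (ge_vals n rR cC x).
Proof.
move=> R01 C01 _ [y _ <-]; apply: gmin01 => i.
by case/andP: (min01 (R01 x (y i)) (C01 (y i))).
Qed.

Lemma lt_vals01 n rR cC x : within01 (lt_vals n rR cC x).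
Proof.
by move=> _ [y _ <-]; apply: gimp01; case: ifP; rewrite lexx ler01.
Qed.

(** The converse of a composition composes the converses in reverse order; this serves [RInv]
    applied to a composition. *)
Lemma comp_vals_flip rR rS x y :
  comp_vals (fun a b => rS b a) (fun a b => rR b a) x y = comp_vals rR rS y x.
Proof. by rewrite /comp_vals; under eq_imagel do rewrite minC. Qed.

(** A path is read backwards: step [i] of the new path is step [n - 1 - i] of the old one. *)
Lemma star_vals_flip_sub rR x y :
  star_vals (fun a b => rR b a) x y `<=` star_vals rR y x.
Proof.
move=> _ [n [u [u0 un ->]]]; exists n, (fun i => u (n - i)%N).
split; rewrite ?subn0 ?subnn// /gmin (reindex_inj rev_ord_inj)/=.
by apply: eq_bigr => i _ /=; rewrite subnSK // subKn // ltnW.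
Qed.

Lemma star_vals_flip rR x y :
  star_vals (fun a b => rR b a) x y = star_vals rR y x.
Proof.
apply/seteqP; split; first exact: star_vals_flip_sub.
exact: (@star_vals_flip_sub (fun a b => rR b a)).
Qed.

End ValueSetsTheory.

(** * Preservation through each role and concept constructor *)

Section Preservation.
Context {R : realType} {D D' : Type} (Z : D -> D' -> R).
Context (Z01 : forall x x', (0 <= Z x x' <= 1)%R).
Local Open Scope ring_scope.

(* [preserved] is [min (Z x x') (cC x) <= cC' x'], stated through lower bounds [t];
   likewise for the conditions on roles. *)
Definition preserved (cC : D -> R) (cC' : D' -> R) := forall x x' t,
  t <= Z x x' -> t <= cC x -> t <= cC' x'.

Definition forth (rR : D -> D -> R) (rR' : D' -> D' -> R) :=
  forall x x' y, exists y', forall t,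
  t <= Z x x' -> t <= rR x y -> t <= Z y y' /\ t <= rR' x' y'.

Definition back (rR : D -> D -> R) (rR' : D' -> D' -> R) :=
  forall x x' y', exists y, forall t,
  t <= Z x x' -> t <= rR' x' y' -> t <= Z y y' /\ t <= rR x y.

(** Threshold form shared by the qualified and unqualified cases. Since [t] is positive, the
    positivity premises of the bisimulation conditions hold; the links between the two tuples are
    absorbed in the degrees of [cC']. *)
Definition count_forth n (rR : D -> D -> R) (cC : D -> R)
    (rR' : D' -> D' -> R) (cC' : D' -> R) :=
  forall x x' t, 0 < t -> t <= Z x x' ->
  forall y : 'I_n -> D, injective y ->
  (forall i, t <= rR x (y i) /\ t <= cC (y i)) ->
  exists2 y' : 'I_n -> D', injective y' &
    forall i, t <= rR' x' (y' i) /\ t <= cC' (y' i).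

Definition count_back n (rR : D -> D -> R) (cC : D -> R)
    (rR' : D' -> D' -> R) (cC' : D' -> R) :=
  forall x x' t, 0 < t -> t <= Z x x' ->
  forall y' : 'I_n -> D', injective y' ->
  (forall i, t <= rR' x' (y' i) /\ t <= cC' (y' i)) ->
  exists2 y : 'I_n -> D, injective y &
    forall i, t <= rR x (y i) /\ t <= cC (y i).

Lemma leZ1 t x x' : t <= Z x x' -> t <= 1.
Proof. by move=> /le_trans; apply; case/andP: (Z01 x x'). Qed.

Lemma eq_forth rR rS rR' rS' :
  rR =2 rS -> rR' =2 rS' -> forth rS rS' -> forth rR rR'.
Proof.
move=> eR eR' fS x x' y; have [y' hy'] := fS x x' y.
by exists y' => t; rewrite eR eR'; exact: hy'.
Qed.

(** At a midpoint [z] attaining the source supremum, a bound [t] applies to both legs, which are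
    matched in turn; the resulting [z'] bounds the target supremum from below. *)
Lemma forth_comp rR rS rR' rS' :
  rel01 rR' -> rel01 rS' ->
  (forall x y, sup_witnessed (comp_vals rR rS x y)) ->
  forth rR rR' -> forth rS rS' ->
  forth (fun x y => sup (comp_vals rR rS x y))
        (fun x y => sup (comp_vals rR' rS' x y)).
Proof.
move=> R01 S01 wit fR fS x x' y.
have [z _ <-] : comp_vals rR rS x y (sup (comp_vals rR rS x y)).
  by apply: sup_attained (wit _ _) _; exists (Num.min (rR x x) (rS x y)), x.
have [z' hz'] := fR x x' z; have [y' hy'] := fS z z' y.
exists y' => t tZ; rewrite le_min => /andP[tR tS].
have [tZz tR'] := hz' t tZ tR; have [tZy tS'] := hy' t tZz tS.
split=> //; apply: (@le_trans _ _ (Num.min (rR' x' z') (rS' z' y'))).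
  by rewrite le_min tR' tS'.
by apply: within01_le_sup; [exact: comp_vals01 | exists z'].
Qed.

Lemma forth_union rR rS rR' rS' : forth rR rR' -> forth rS rS' ->
  forth (fun x y => Num.max (rR x y) (rS x y))
        (fun x y => Num.max (rR' x y) (rS' x y)).
Proof.
(* The larger degree is singled out before [t], as one [y'] must serve every [t]. *)
move=> fR fS x x' y; have [RS|/ltW SR] := leP (rR x y) (rS x y).
  have [y' hy'] := fS x x' y; exists y' => t tZ /(hy' t tZ)[-> tS].
  by rewrite le_max tS orbT.
have [y' hy'] := fR x x' y; exists y' => t tZ /(hy' t tZ)[-> tR].
by rewrite le_max tR.
Qed.

(** A path attaining the source supremum is copied edge by edge. *)
Lemma forth_star rR rR' :
  rel01 rR' -> (forall x y, sup_witnessed (star_vals rR x y)) ->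
  forth rR rR' ->
  forth (fun x y => sup (star_vals rR x y)) (fun x y => sup (star_vals rR' x y)).
Proof.
move=> R01 wit fR x x' y.
have [n [u [u0 un ->]]] : star_vals rR x y (sup (star_vals rR x y)).
  apply: sup_attained (wit _ _) _.
  (* The one-edge path from [x] to [y] shows that the value set is nonempty. *)
  exists (gmin (fun i : 'I_1 => rR (if i == 0 :> nat then x else y) y)), 1%N.
  by exists (fun i => if i == 0%N then x else y); split.
(* A choice function for [forth], independent of [t], so that the copied path can be fixed before
   [t]. *)
have [f hf] : exists f, forall a a' b t, t <= Z a a' -> t <= rR a b ->
    t <= Z b (f a a' b) /\ t <= rR' a' (f a a' b).
  exists (fun a a' b => sval (cid (fR a a' b))) => a a' b.
  by case: cid.
pose fix u' i := if i is j.+1 then f (u j) (u' j) (u i) else x'.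
exists (u' n) => t tZ /le_gminP[t1 tR].
have tZu k : (k <= n)%N -> t <= Z (u k) (u' k).
  elim: k => [|k IH] kn; first by rewrite u0.
  by have [] := hf _ _ _ _ (IH (ltnW kn)) (tR (Ordinal kn)).
split; first by rewrite -un; exact: tZu.
apply: (@le_trans _ _ (gmin (fun i : 'I_n => rR' (u' i) (u' i.+1)))).
  apply/le_gminP; split=> // i.
  by have [] := hf _ _ _ _ (tZu i (ltnW (ltn_ord i))) (tR i).
by apply: within01_le_sup; [exact: star_vals01 | exists n, u'].
Qed.

Lemma forth_test cC cC' : fun01 cC' -> preserved cC cC' ->
  forth (fun x y => if `[< x = y >] then cC x else 0)
        (fun x y => if `[< x = y >] then cC' x else 0).
Proof.
move=> C01 pC x x' y; exists x' => t tZ; rewrite (asboolT (erefl x')).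
case: asboolP => [<-|_] tC; first by split=> //; exact: pC tZ tC.
(* Off the diagonal the test has degree 0, so [t <= 0] and both bounds are trivial. *)
have /andP[Z0 _] := Z01 y x'; have /andP[C0 _] := C01 x'.
by rewrite !(le_trans tC).
Qed.

(** The antecedent is contravariant, so it must be carried from [x'] to [x]. By residuation the
    argument runs at the level [Num.min t (cC' x')]. *)
Lemma preserved_imp cC dC cC' dC' :
  (forall x x' t, t <= Z x x' -> t <= cC' x' -> t <= cC x) ->
  preserved dC dC' ->
  preserved (fun x => gimp (cC x) (dC x)) (fun x => gimp (cC' x) (dC' x)).
Proof.
move=> bC pD x x' t tZ; have t1 := leZ1 tZ; rewrite !le_gimp// => tCD.
have sZ : Num.min t (cC' x') <= Z x x' by rewrite ge_min tZ.
apply: (pD _ _ _ sZ); apply: le_trans tCD.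
by rewrite le_min ge_min lexx/=; apply: bC sZ _; rewrite ge_min lexx orbT.
Qed.

Lemma preserved_ex rR rR' cC cC' : rel01 rR' -> fun01 cC' ->
  (forall x, sup_witnessed (ex_vals rR cC x)) ->
  forth rR rR' -> preserved cC cC' ->
  preserved (fun x => sup (ex_vals rR cC x)) (fun x => sup (ex_vals rR' cC' x)).
Proof.
move=> R01 C01 wit fR pC x x' t tZ.
have [y _ <-] : ex_vals rR cC x (sup (ex_vals rR cC x)).
  by apply: sup_attained (wit _) _; exists (Num.min (rR x x) (cC x)), x.
have [y' hy'] := fR x x' y.
rewrite le_min => /andP[tR tC]; have [tZy tR'] := hy' t tZ tR.
apply: (@le_trans _ _ (Num.min (rR' x' y') (cC' y'))).
  by rewrite le_min tR' (pC _ _ _ tZy tC).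
by apply: within01_le_sup; [exact: ex_vals01 | exists y'].
Qed.

(** A lower bound of the target infimum is checked member by member, so each [y'] is pulled back to
    some [y]. *)
Lemma preserved_all rR rR' cC cC' : fun01 cC ->
  back rR rR' -> preserved cC cC' ->
  preserved (fun x => inf (all_vals rR cC x))
            (fun x => inf (all_vals rR' cC' x)).
Proof.
move=> C01 bR pC x x' t tZ tinf; have t1 := leZ1 tZ.
apply: lb_le_inf; first by exists (gimp (rR' x' x') (cC' x')), x'.
move=> _ [y' _ <-]; rewrite le_gimp//.
have [y hy] := bR x x' y'; set s := Num.min t _.
have st : s <= t by rewrite ge_min lexx.
have [|sZ sR] := hy s (le_trans st tZ); first by rewrite ge_min lexx orbT.
apply: pC sZ _.
have : t <= gimp (rR x y) (cC y).
  apply: le_trans tinf _.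
  by apply: within01_ge_inf; [exact: all_vals01 | exists y].
by rewrite le_gimp//; apply: le_trans; rewrite le_min st.
Qed.

Lemma preserved_ge n rR rR' cC cC' : rel01 rR' -> fun01 cC' ->
  (forall x, sup_witnessed (ge_vals n rR cC x)) ->
  count_forth n rR cC rR' cC' ->
  preserved (fun x => sup (ge_vals n rR cC x))
            (fun x => sup (ge_vals n rR' cC' x)).
Proof.
move=> R01 C01 wit cf x x' t tZ tsup; have V01 := ge_vals01 R01 C01.
have [t0|t0] := leP t 0.
  (* For [t <= 0] the claim is trivial. For [t > 0] the source value set is nonempty, since the
     empty supremum is 0. *)
  by apply: le_trans t0 _; case/andP: (sup01 (V01 n x')).
have [E0|/set0P V0] := eqVneq (ge_vals n rR cC x) set0.
  by move: tsup; rewrite E0 sup0 leNgt t0.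
have [y /= yinj Ey] := sup_attained (wit x) V0.
move: tsup; rewrite -Ey => /le_gminP[t1 tRC].
have [|y' y'inj tRC'] := cf x x' t t0 tZ y yinj.
  by move=> i; apply/andP; rewrite -le_min.
apply: le_trans (within01_le_sup (V01 n x') (imageP _ y'inj)).
by apply/le_gminP; split=> // i; rewrite le_min; apply/andP.
Qed.

(** Tuples with a repetition have value 1. An injective target tuple with a positive level [s] would
    pull back to an injective source tuple violating the bound [t] on the source infimum. *)
Lemma preserved_lt n rR rR' cC cC' : inhabited D' ->
  count_back n rR cC rR' cC' ->
  preserved (fun x => inf (lt_vals n rR cC x))
            (fun x => inf (lt_vals n rR' cC' x)).
Proof.
move=> [d'] cb x x' t tZ tinf; have t1 := leZ1 tZ.
apply: lb_le_inf; first by eexists; exists (fun=> d').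
move=> _ [y' _ <-]; rewrite le_gimp//.
case: asboolP => [_|ninj]; first by rewrite ge_min t1.
have y'inj : injective y'.
  move=> j k yjk; apply: contrapT => /eqP; rewrite neq_ltn => /orP[jk|kj].
    by apply: ninj; exists j, k.
  by apply: ninj; exists k, j.
rewrite leNgt; apply/negP; set s := Num.min t _ => s0.
have st : s <= t by rewrite ge_min lexx.
have [s1 sRC'] : s <= 1 /\ forall i, s <= Num.min (rR' x' (y' i)) (cC' (y' i)).
  by apply/le_gminP; rewrite ge_min lexx orbT.
have [|y yinj sRC] := cb x x' s s0 (le_trans st tZ) y' y'inj.
  by move=> i; apply/andP; rewrite -le_min.
have := le_trans tinf (within01_ge_inf (@lt_vals01 _ _ n rR cC x)
  (imageP _ (I : [set: 'I_n -> D] y))).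
rewrite le_gimp// asboolF; last first.
  by move=> [j [k [jk /yinj ejk]]]; rewrite ejk ltnn in jk.
(* The source tuple gives a minimum at most 0, yet [s] lies below both of its arguments. *)
rewrite leNgt => /negP; apply; apply: lt_le_trans s0 _; rewrite le_min st /=.
by apply/le_gminP; split=> // i; rewrite le_min; apply/andP.
Qed.

End Preservation.

(** * Bisimulations and the language: bounds, symmetry and the main induction *)

Section Semantics.
Context {R : realType} {CN RN IN : Type} (Phi : set feature).
Local Open Scope ring_scope.
Implicit Types (P : role R CN RN IN) (C : concept R CN RN IN).

Lemma basic_role_in P : basic_role Phi P -> role_in Phi P.
Proof. by case: P => //= -[]. Qed.

Lemma sem01 (I : interp R CN RN IN) :
  (forall P, role_in Phi P -> rel01 (@role_sem _ _ _ _ I P)) /\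
  (forall C, concept_in Phi C -> fun01 (@concept_sem _ _ _ _ I C)).
Proof.
apply: role_concept_ind => /=.
- by move=> r _ x y; exact: rname_of01.
- by move=> P1 IH1 P2 IH2 [/IH1 h1 /IH2 h2] x y; exact/sup01/comp_vals01.
- by move=> P1 IH1 P2 IH2 [/IH1 h1 /IH2 h2] x y; exact: max01.
- by move=> P IH /IH h x y; exact/sup01/star_vals01.
- by move=> C IH /IH h x y; case: ifP => _ //; rewrite lexx ler01.
- by move=> P IH [_ /IH h] x y.
- by move=> _ x y; rewrite lexx ler01.
- by move=> p p01 x.
- by move=> A _ x; exact: cname_of01.
- by move=> C1 IH1 C2 IH2 [/IH1 h1 /IH2 h2] x; exact: min01.
- by move=> C1 _ C2 IH2 [_ /IH2 h2] x; exact: gimp01.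
- by move=> C _ _ x; rewrite /gneg; case: ifP; rewrite lexx ler01.
- by move=> C1 IH1 C2 IH2 [/IH1 h1 /IH2 h2] x; exact: max01.
- by move=> P _ C IH [_ /IH h] x; exact/inf01/all_vals01.
- by move=> P IH1 C IH2 [/IH1 h1 /IH2 h2] x; exact/sup01/ex_vals01.
- by move=> a _ x; case: ifP; rewrite lexx ler01.
- by move=> r _ x; exact: rname_of01.
- move=> n P IH1 C IH2 [_ /basic_role_in/IH1 h1 /IH2 h2] x.
  exact/sup01/ge_vals01.
- by move=> n P _ C _ _ x; exact/inf01/lt_vals01.
- move=> n P IH [_ /basic_role_in/IH h] x; apply/sup01/ge_vals01 => // y.
  by rewrite ler01 lexx.
- by move=> n P _ _ x; exact/inf01/lt_vals01.
Qed.

(** Forth and back conditions trade places, and the remaining ones are symmetric. *)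
Lemma fuzzy_bisimulation_sym (I I' : interp R CN RN IN)
    (Z : dom I -> dom I' -> R) :
  fuzzy_bisimulation Phi Z -> fuzzy_bisimulation Phi (fun x' x => Z x x').
Proof.
case=> Z01 Zc Zf Zb Zn Zuf Zub Zs Zqf Zqb Znf Znb; split.
- by [].
- by move=> x' x A; rewrite geqvC.
- by move=> x' x; exact: Zb.
- by move=> x' x; exact: Zf.
- by move=> hO x' x a h; apply: (Zn hO x x' a); case: h => -[]; [right|left].
- by move=> hU x' x; exact: Zub.
- by move=> hU x' x; exact: Zuf.
- by move=> hS x' x r; rewrite geqvC; exact: Zs.
- by move=> n hn x' x; exact: Zqb.
- by move=> n hn x' x; exact: Zqf.
- by move=> n hn x' x; exact: Znb.
- by move=> n hn x' x; exact: Znf.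
Qed.

Section Bisimulation.
Context (I I' : interp R CN RN IN) (Z : dom I -> dom I' -> R).
Context (bisimZ : fuzzy_bisimulation Phi Z).

Lemma basic_forth P : basic_role Phi P ->
  forth Z (@role_sem _ _ _ _ I P) (@role_sem _ _ _ _ I' P).
Proof.
move=> bP x x' y; have [y' hy'] := bisim_forth bisimZ x x' bP y.
exists y' => t tZ tP; apply/andP; rewrite -le_min; apply: le_trans hy'.
by rewrite le_min tZ.
Qed.

(** Each [y' i] is linked at degree at least [t] to some [y j], and preservation carries the degree
    of [C] along that link. *)
Lemma count_forth_Q n P C : Phi (FQ n) -> basic_role Phi P ->
  preserved Z (@concept_sem _ _ _ _ I C) (@concept_sem _ _ _ _ I' C) ->
  count_forth Z n (@role_sem _ _ _ _ I P) (@concept_sem _ _ _ _ I C)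
                  (@role_sem _ _ _ _ I' P) (@concept_sem _ _ _ _ I' C).
Proof.
move=> hn bP pC x x' t t0 tZ y yinj tRC.
have [|y' y'inj hy'] :=
  bisim_Q_forth bisimZ hn bP (lt_le_trans t0 tZ) yinj.
  by move=> j; apply: lt_le_trans t0 _; case: (tRC j).
exists y' => // i; have [j hj] := hy' i.
have /andP[tZy tR'] : (t <= Z (y j) (y' i)) && (t <= role_sem P x' (y' i)).
  rewrite -le_min; apply: le_trans hj; rewrite le_min tZ /=.
  apply/le_gminP; split=> [|k]; last by case: (tRC k).
  exact: leZ1 (bisim01 bisimZ) _ _ _ tZ.
by split=> //; apply: pC tZy _; case: (tRC j).
Qed.

Lemma count_forth_N n P : Phi (FN n) -> basic_role Phi P ->
  count_forth Z n (@role_sem _ _ _ _ I P) (fun=> 1)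
                  (@role_sem _ _ _ _ I' P) (fun=> 1).
Proof.
move=> hn bP x x' t t0 tZ y yinj tRC.
have [|y' y'inj hy'] :=
  bisim_N_forth bisimZ hn bP (lt_le_trans t0 tZ) yinj.
  by move=> j; apply: lt_le_trans t0 _; case: (tRC j).
have t1 : t <= 1 by exact: leZ1 (bisim01 bisimZ) _ _ _ tZ.
exists y' => // i; split=> //; apply: le_trans (hy' i); rewrite le_min tZ /=.
by apply/le_gminP; split=> // k; case: (tRC k).
Qed.

End Bisimulation.

(* The inverse of a role is preserved along with it because [RInv] may be
   applied to any role, whereas bisimulations only mention basic roles. *)
Lemma bisimulation_forth_preserved :
  (forall P, role_in Phi P ->
     forall (I I' : interp R CN RN IN) (Z : dom I -> dom I' -> R),
     witnessed I Phi -> witnessed I' Phi -> fuzzy_bisimulation Phi Z ->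
     forth Z (@role_sem _ _ _ _ I P) (@role_sem _ _ _ _ I' P) /\
     (Phi FI -> forth Z (fun x y => @role_sem _ _ _ _ I P y x)
                        (fun x y => @role_sem _ _ _ _ I' P y x))) /\
  (forall C, concept_in Phi C ->
     forall (I I' : interp R CN RN IN) (Z : dom I -> dom I' -> R),
     witnessed I Phi -> witnessed I' Phi -> fuzzy_bisimulation Phi Z ->
     preserved Z (@concept_sem _ _ _ _ I C) (@concept_sem _ _ _ _ I' C)).
Proof.
apply: role_concept_ind.
- move=> r _ I I' Z _ _ bZ; split=> [|hI]; first exact: (basic_forth bZ).
  (* The inverse of a role name is itself basic when [FI] is in [Phi]. *)
  exact: (basic_forth bZ (P := RInv (RName _ _ _ r))).
- move=> P1 IH1 P2 IH2 h12 I I' Z wI wI' bZ; have [h1 h2] := h12.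
  have [f1 g1] := IH1 h1 I I' Z wI wI' bZ.
  have [f2 g2] := IH2 h2 I I' Z wI wI' bZ.
  have r01 := (sem01 I').1.
  split=> [|hI] /=.
    apply: forth_comp => //; [exact: r01|exact: r01|].
    exact: witnessed_comp wI _ _ h12.
  apply: (eq_forth _ _ (forth_comp _ _ _ (g2 hI) (g1 hI))).
  + by move=> x y; rewrite comp_vals_flip.
  + by move=> x y; rewrite comp_vals_flip.
  + by move=> x y; exact: r01.
  + by move=> x y; exact: r01.
  + by move=> x y; rewrite comp_vals_flip; exact: witnessed_comp wI _ _ h12 _ _.
- move=> P1 IH1 P2 IH2 [h1 h2] I I' Z wI wI' bZ.
  have [f1 g1] := IH1 h1 I I' Z wI wI' bZ.
  have [f2 g2] := IH2 h2 I I' Z wI wI' bZ.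
  by split=> [|hI]; apply: forth_union => //; [exact: g1|exact: g2].
- move=> P IH hP I I' Z wI wI' bZ.
  have [f g] := IH hP I I' Z wI wI' bZ; have r01 := (sem01 I').1 P hP.
  have wit := @witnessed_star _ _ _ _ _ _ wI P hP.
  split=> [|hI] /=; first exact: forth_star.
  apply: (eq_forth _ _ (forth_star _ _ (g hI))).
  + by move=> x y; rewrite star_vals_flip.
  + by move=> x y; rewrite star_vals_flip.
  + by move=> x y; exact: r01.
  + by move=> x y; rewrite star_vals_flip.
- move=> C IH hC I I' Z wI wI' bZ; have c01 := (sem01 I').2 _ hC.
  have f := forth_test (bisim01 bZ) c01 (IH hC I I' Z wI wI' bZ).
  split=> // _ x x' y; have [y' hy'] := f x x' y; exists y' => t tZ /=.
  (* A test is a symmetric relation, hence its own converse. *)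
  have testC (J : interp R CN RN IN) (a b : dom J) :
      (if `[< b = a >] then concept_sem C b else 0) =
      (if `[< a = b >] then concept_sem C a else 0).
    by case: asboolP => [->|ba]; case: asboolP => // ab; case: ba.
  by rewrite !(testC _ x) !(testC _ x'); exact: hy'.
- move=> P IH [hI hP] I I' Z wI wI' bZ.
  (* The two halves of the claim trade places: a double inverse is [P] again. *)
  by have [f g] := IH hP I I' Z wI wI' bZ; split=> //=; exact: g.
- move=> hU I I' Z _ _ bZ.
  suff f : forth Z (fun _ _ => 1) (fun _ _ => 1) by split.
  move=> x x' y; have [y' hy'] := bisim_univ_forth bZ hU x x' y.
  by exists y' => t tZ t1; split=> //; exact: le_trans hy'.
- by move=> p _ I I' Z _ _ _ x x' t.
- move=> A _ I I' Z _ _ bZ x x' t tZ; have t1 := leZ1 (bisim01 bZ) tZ.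
  by apply: (le_geqv_trans t1); exact: le_trans tZ (bisim_cname bZ _ _ _).
- move=> C1 IH1 C2 IH2 [h1 h2] I I' Z wI wI' bZ x x' t tZ /=.
  rewrite !le_min => /andP[tC1 tC2].
  by rewrite (IH1 h1 _ _ _ wI wI' bZ _ _ _ tZ tC1)
             (IH2 h2 _ _ _ wI wI' bZ _ _ _ tZ tC2).
- move=> C1 IH1 C2 IH2 [h1 h2] I I' Z wI wI' bZ.
  apply: (preserved_imp (bisim01 bZ)); last exact: IH2.
  by move=> x x'; exact: (IH1 h1 _ _ _ wI' wI (fuzzy_bisimulation_sym bZ)).
- move=> C IH hC I I' Z wI wI' bZ x x' /=.
  have /andP[C0 _] := (sem01 I).2 C hC x.
  have /andP[C'0 _] := (sem01 I').2 C hC x'.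
  (* Negation is handled as implication into the constant 0. *)
  rewrite !gneg_gimp//.
  apply: (preserved_imp (bisim01 bZ) (dC := fun=> 0) (dC' := fun=> 0)) => //.
  by move=> y y'; exact: (IH hC _ _ _ wI' wI (fuzzy_bisimulation_sym bZ)).
- move=> C1 IH1 C2 IH2 [h1 h2] I I' Z wI wI' bZ x x' t tZ /=.
  rewrite !le_max => /orP[tC1|tC2].
    by rewrite (IH1 h1 _ _ _ wI wI' bZ _ _ _ tZ tC1).
  by rewrite (IH2 h2 _ _ _ wI wI' bZ _ _ _ tZ tC2) orbT.
- move=> P IHP C IHC hPC I I' Z wI wI' bZ; have [hP hC] := hPC.
  apply: (preserved_all (bisim01 bZ)); last exact: IHC.
    exact: (sem01 I).2.
  move=> x x'; exact: (IHP hP _ _ _ wI' wI (fuzzy_bisimulation_sym bZ)).1.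
- move=> P IHP C IHC hPC I I' Z wI wI' bZ; have [hP hC] := hPC.
  apply: preserved_ex; [exact: (sem01 I').1|exact: (sem01 I').2| | |exact: IHC].
    exact: witnessed_ex wI _ _ hPC.
  exact: (IHP hP _ _ _ wI wI' bZ).1.
- move=> a hO I I' Z _ _ bZ x x' t tZ /=.
  have Z1 := leZ1 (bisim01 bZ) tZ.
  case: asboolP => xa; case: asboolP => x'a //.
  (* What remains is that [x] is named by [a] and [x'] is not; then [Z x x' = 0] forces [t <= 0]. *)
  by move: tZ; rewrite (bisim_nom bZ hO (a := a))//; left.
- move=> r hS I I' Z _ _ bZ x x' t tZ; have t1 := leZ1 (bisim01 bZ) tZ.
  by apply: (le_geqv_trans t1); exact: le_trans tZ (bisim_self bZ hS _ _ _).
- move=> n P _ C IHC hPC I I' Z wI wI' bZ; have [hn bP hC] := hPC.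
  apply: preserved_ge.
  + exact: (sem01 I').1 _ (basic_role_in bP).
  + exact: (sem01 I').2.
  + exact: witnessed_geQ wI _ _ _ hPC.
  + by apply: count_forth_Q => //; exact: IHC.
- move=> n P _ C IHC [hn bP hC] I I' Z wI wI' bZ.
  apply: (preserved_lt (bisim01 bZ)); first exact: dom_inhabited.
  move=> x x'; have bZ' := fuzzy_bisimulation_sym bZ.
  exact: (count_forth_Q bZ' hn bP (IHC hC _ _ _ wI' wI bZ')).
- move=> n P _ hP I I' Z wI wI' bZ; have [hn bP] := hP.
  apply: preserved_ge.
  + exact: (sem01 I').1 _ (basic_role_in bP).
  + by move=> x; rewrite ler01 lexx.
  + exact: witnessed_geN wI _ _ hP.
  + exact: count_forth_N.
- move=> n P _ [hn bP] I I' Z wI wI' bZ.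
  apply: (preserved_lt (bisim01 bZ)); first exact: dom_inhabited.
  by move=> x x'; exact: (count_forth_N (fuzzy_bisimulation_sym bZ) hn bP).
Qed.

(** * Transfer of fuzzy TBoxes *)

Lemma bisimilar_sym (I I' : interp R CN RN IN) :
  bisimilar Phi I I' -> bisimilar Phi I' I.
Proof.
move=> [hIN [Z bZ Za]]; split=> //.
by exists (fun x' x => Z x x') => //; exact: fuzzy_bisimulation_sym.
Qed.

Lemma bisimilar_tbox_valid (I I' : interp R CN RN IN) (T : set (gci R CN RN IN)) :
  Phi FU -> (forall g, T g -> gci_in Phi g) ->
  witnessed I Phi -> witnessed I' Phi -> bisimilar Phi I I' ->
  tbox_valid I T -> tbox_valid I' T.
Proof.
move=> hU hT wI wI' [[a] [Z bZ Za]] IT g Tg x'.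
have [hl hr _] := hT g Tg.
(* Every [x'] gets a partner [x] at degree at least that of the pair named by [a], which is 1. *)
have [x Zx] := bisim_univ_back bZ hU (ind_of I a) (ind_of I' a) x'.
have := bisimulation_forth_preserved.2 (CImp (gci_lhs g) (gci_rhs g))
  (conj hl hr) I I' Z wI wI' bZ x x'.
move: (IT g Tg x); rewrite Za in Zx; set v := concept_sem _ x => /= gv pv.
have /andP[_ v1] : 0 <= v <= 1 by exact: ((sem01 I).2 (CImp _ _) (conj hl hr) x).
(* The threshold is the value [v] at [x] itself, admissible because [v <= 1 <= Z x x']. *)
have := pv v (le_trans v1 Zx) (lexx _).
by case: gci_rel gv => gv; [exact: le_trans | exact: lt_le_trans].
Qed.

End Semantics.

Theorem theorem2 (R : realType) (CN RN IN : Type) (Phi : set feature)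
    (hPhi : Phi `<=` features) (hU : Phi FU)
    (T : set (gci R CN RN IN)) (hT : fuzzy_tbox Phi T)
    (I I' : interp R CN RN IN)
    (hI : witnessed I Phi) (hI' : witnessed I' Phi)
    (hII' : bisimilar Phi I I') :
  tbox_valid I T <-> tbox_valid I' T.
Proof.
split; apply: (bisimilar_tbox_valid hU hT.2) => //; exact: bisimilar_sym.
Qed.
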